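(* Let $\mathcal{D}_1,\mathcal{D}_2\subset\mathcal{T}_{\mathbb{P}^{1|2}}$ be the subsheaves generated respectively by the global sections $$D_1=\alpha_1(\partial_{\theta_1}+\theta_2\partial_z)+\alpha_2(z\theta_2\partial_z-\theta_1\theta_2\partial_{\theta_1}+z\partial_{\theta_1})=[\alpha_1+\alpha_2(z-\theta_1\theta_2)](\partial_{\theta_1}+\theta_2\partial_z),$$ $$D_2=\beta_1(\partial_{\theta_2}+\theta_1\partial_z)+\beta_2(z\theta_1\partial_z+\theta_1\theta_2\partial_{\theta_2}+z\partial_{\theta_2})=[\beta_1+\beta_2(z+\theta_1\theta_2)](\partial_{\theta_2}+\theta_1\partial_z),$$ as $\alpha_1,\alpha_2,\beta_1,\beta_2$ vary in $\mathbb{C}$. Then $\mathcal{D}_1$ and $\mathcal{D}_2$ are invertible sheaves of rank $0|1$ and $(\mathbb{P}^{1|2},\mathcal{D}_1,\mathcal{D}_2)$ is an $\mathcal{N}=2$ super Riemann surface.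
   Context: $\mathbb{P}^{1|2}$ is the complex projective superspace of dimension $1|2$, covered by two affine charts with coordinates $(z|\theta_1,\theta_2)$ and $(w|\phi_1,\phi_2)$ related by $z=1/w$, $\theta_i=\phi_i/w$; sections of the tangent sheaf $\mathcal{T}_{\mathbb{P}^{1|2}}$ are written in the first chart. An $\mathcal{N}=2$ super Riemann surface is a triple $(\mathcal{M},\mathcal{D}_1,\mathcal{D}_2)$, where $\mathcal{M}$ is a complex supermanifold of dimension $1|2$ and $\mathcal{D}_1,\mathcal{D}_2$ are sub-sheaves of rank $0|1$ of $\mathcal{T}_{\mathcal{M}}$ (the structure distributions), locally generated by odd vector fields $D_1,D_2$ respectively, which are integrable (i.e. $D_i^2=f_iD_i$ for some odd function $f_i$) and such that $\mathcal{D}_1,\mathcal{D}_2$ and $\mathcal{D}_1\otimes\mathcal{D}_2$ generate $\mathcal{T}_{\mathcal{M}}$ at any point, meaning that $D_1$, $D_2$ and the anticommutator $\{D_1,D_2\}$ of local generators generate $\mathcal{T}_{\mathcal{M}}$. *)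

(* Defs.v *)
From HB Require Import structures.
From mathcomp Require Import all_boot all_order all_algebra.
From mathcomp Require Import all_classical all_reals all_analysis.
From mathcomp Require Import complex.

Set Implicit Arguments.
Unset Strict Implicit.
Unset Printing Implicit Defensive.

Import Order.TTheory GRing.Theory Num.Theory.
Import numFieldNormedType.Exports.

Local Open Scope classical_set_scope.
Local Open Scope ring_scope.

(* R[i] is the field of complex numbers; typing it as a numClosedFieldType makes
   its normed-space structure over itself (hence complex derivatives)
   inferable. The definitions below only depend on that structure, written C,
   and are meant for C := Cx R. *)
Definition Cx (R : realType) : numClosedFieldType := R[i].

(* a0 + a1 theta_1 + a2 theta_2 + a12 theta_1 theta_2 *)
Record grass (C : numClosedFieldType) :=
  Grass { g0 : C; g1 : C; g2 : C; g12 : C }.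

Section Grassmann.
Variable C : numClosedFieldType.
Implicit Types a b : grass C.

Definition gadd a b :=
  Grass (g0 a + g0 b) (g1 a + g1 b) (g2 a + g2 b) (g12 a + g12 b).

(* theta_1^2 = theta_2^2 = 0 and theta_2 theta_1 = - theta_1 theta_2 *)
Definition gmul a b :=
  Grass (g0 a * g0 b)
        (g0 a * g1 b + g1 a * g0 b)
        (g0 a * g2 b + g2 a * g0 b)
        (g0 a * g12 b + g12 a * g0 b + g1 a * g2 b - g2 a * g1 b).

Definition gconst (c : C) := Grass c 0 0 0.

Definition geven a := g1 a = 0 /\ g2 a = 0.
Definition godd a := g0 a = 0 /\ g12 a = 0.

(* left derivatives *)
Definition gd1 a := Grass (g1 a) 0 (g12 a) 0.
Definition gd2 a := Grass (g2 a) (- g12 a) 0 0.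

End Grassmann.

(* A superfunction is only meaningful on the open set of C where it is being
   considered; its values elsewhere are junk. *)
Definition superfun (C : numClosedFieldType) := C -> grass C.

Section Superfunctions.
Variable C : numClosedFieldType.
Implicit Types (f g : superfun C) (S : set C).

Definition sadd f g : superfun C := fun z => gadd (f z) (g z).
Definition smul f g : superfun C := fun z => gmul (f z) (g z).
Definition sconst (c : C) : superfun C := fun=> gconst c.
Definition szvar : superfun C := fun z => gconst z.
Definition stheta1 : superfun C := fun=> Grass 0 1 0 0.
Definition stheta2 : superfun C := fun=> Grass 0 0 1 0.

Definition sfeq S f g := forall z, S z -> f z = g z.
Definition sfeven S f := forall z, S z -> geven (f z).
Definition sfodd S f := forall z, S z -> godd (f z).

(* to be used with S open *)
Definition sfholo S f := forall z, S z ->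
  [/\ derivable (fun x : C => g0 (f x)) z 1,
      derivable (fun x : C => g1 (f x)) z 1,
      derivable (fun x : C => g2 (f x)) z 1
    & derivable (fun x : C => g12 (f x)) z 1].

Definition sdz f : superfun C := fun z =>
  Grass (derive1 (fun x : C => g0 (f x)) z)
        (derive1 (fun x : C => g1 (f x)) z)
        (derive1 (fun x : C => g2 (f x)) z)
        (derive1 (fun x : C => g12 (f x)) z).
Definition sd1 f : superfun C := fun z => gd1 (f z).
Definition sd2 f : superfun C := fun z => gd2 (f z).

End Superfunctions.

Infix "+f" := sadd (at level 50, left associativity).
Infix "*f" := smul (at level 40, left associativity).

(* the change of supercoordinates (z | theta_1, theta_2) |-> (mz | m1, m2) *)
Record smap (C : numClosedFieldType) :=
  SMap { mz : superfun C; m1 : superfun C; m2 : superfun C }.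

Section Changes.
Variable C : numClosedFieldType.
Implicit Types (F : smap C) (f : superfun C).

Definition sid : smap C := SMap (@szvar C) (@stheta1 C) (@stheta2 C).

(* Taylor expansion of u at an even element of the Grassmann algebra: its
   nilpotent part g12 a * theta_1 theta_2 has square zero. *)
Definition geval (u : C -> C) (a : grass C) : grass C :=
  Grass (u (g0 a)) 0 0 (derive1 u (g0 a) * g12 a).

(* f (mz | m1, m2) *)
Definition spull F f : superfun C := fun z =>
  let u0 := geval (fun x : C => g0 (f x)) (mz F z) in
  let u1 := geval (fun x : C => g1 (f x)) (mz F z) in
  let u2 := geval (fun x : C => g2 (f x)) (mz F z) in
  let u12 := geval (fun x : C => g12 (f x)) (mz F z) in
  gadd (gadd (gadd u0 (gmul u1 (m1 F z))) (gmul u2 (m2 F z)))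
       (gmul u12 (gmul (m1 F z) (m2 F z))).

End Changes.

(* vz d/dz + v1 d/dtheta_1 + v2 d/dtheta_2 *)
Record vfield (C : numClosedFieldType) :=
  VField { vz : superfun C; v1 : superfun C; v2 : superfun C }.

Section VectorFields.
Variable C : numClosedFieldType.
Implicit Types (X Y : vfield C) (f : superfun C) (S : set C).

Definition vadd X Y := VField (vz X +f vz Y) (v1 X +f v1 Y) (v2 X +f v2 Y).
Definition vmul f X := VField (f *f vz X) (f *f v1 X) (f *f v2 X).
Definition vzero := VField (sconst (0 : C)) (sconst (0 : C)) (sconst (0 : C)).

Definition vdz := VField (sconst (1 : C)) (sconst (0 : C)) (sconst (0 : C)).
Definition vd1 := VField (sconst (0 : C)) (sconst (1 : C)) (sconst (0 : C)).
Definition vd2 := VField (sconst (0 : C)) (sconst (0 : C)) (sconst (1 : C)).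

Definition vapp X f : superfun C :=
  vz X *f sdz f +f v1 X *f sd1 f +f v2 X *f sd2 f.

Definition vfeq S X Y :=
  [/\ sfeq S (vz X) (vz Y), sfeq S (v1 X) (v1 Y) & sfeq S (v2 X) (v2 Y)].
Definition vfholo S X := [/\ sfholo S (vz X), sfholo S (v1 X) & sfholo S (v2 X)].
Definition vfodd S X := [/\ sfodd S (vz X), sfeven S (v1 X) & sfeven S (v2 X)].

(* For X and Y odd, X o X and X o Y + Y o X are derivations; they are given by
   their values on the coordinates z, theta_1, theta_2. *)
Definition vsquare X :=
  VField (vapp X (vz X)) (vapp X (v1 X)) (vapp X (v2 X)).
Definition vanticomm X Y :=
  VField (vapp X (vz Y) +f vapp Y (vz X))
         (vapp X (v1 Y) +f vapp Y (v1 X))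
         (vapp X (v2 Y) +f vapp Y (v2 X)).

End VectorFields.

Infix "+v" := vadd (at level 50, left associativity).
Infix "*v" := vmul (at level 40, left associativity).

(* [trans i j] expresses the supercoordinates of chart j as superfunctions of
   those of chart i. *)
Record superatlas (C : numClosedFieldType) := SuperAtlas {
  space : topologicalType;
  idx : Type;
  dom : idx -> set space;
  coord : idx -> space -> C;
  trans : idx -> idx -> smap C }.

Section Supermanifolds.
Variables (C : numClosedFieldType) (M : superatlas C).
Implicit Types (V : set (space M)) (i j k : idx M).

Definition patch i V : set C := coord i @` (V `&` dom i).

Definition is_supermanifold : Prop :=
  [/\ hausdorff_space (space M) /\ @second_countable (space M),
      forall x : space M, exists i, dom i x,
      forall i,
        [/\ open (dom i), set_inj (dom i) (coord i)
          & forall V, V `<=` dom i -> (open V <-> open (coord i @` V))],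
      forall i j, let S := patch i (dom j) in
        [/\ [/\ sfholo S (mz (trans i j)), sfholo S (m1 (trans i j))
              & sfholo S (m2 (trans i j))],
            [/\ sfeven S (mz (trans i j)), sfodd S (m1 (trans i j))
              & sfodd S (m2 (trans i j))]
          & forall x, dom i x -> dom j x ->
              g0 (mz (trans i j) (coord i x)) = coord j x]
    & (forall i, let S := patch i (dom i) in
        [/\ sfeq S (mz (trans i i)) (mz (sid C)),
            sfeq S (m1 (trans i i)) (m1 (sid C))
          & sfeq S (m2 (trans i i)) (m2 (sid C))]) /\
      (forall i j k, let S := patch i (dom j `&` dom k) in
        [/\ sfeq S (mz (trans i k)) (spull (trans i j) (mz (trans j k))),
            sfeq S (m1 (trans i k)) (spull (trans i j) (m1 (trans j k)))
          & sfeq S (m2 (trans i k)) (spull (trans i j) (m2 (trans j k)))])].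

(* Sections of the structure sheaf and of the tangent sheaf over V are given
   by their expressions in all the charts. *)

Definition ofam := idx M -> superfun C.
Definition tfam := idx M -> vfield C.

Definition osection V (h : ofam) : Prop :=
  (forall i, sfholo (patch i V) (h i)) /\
  (forall i j, sfeq (patch i (V `&` dom j)) (spull (trans i j) (h j)) (h i)).

(* On overlaps, the coefficients of X j are the values of the derivation X i
   on the coordinates of chart j. *)
Definition tsection V (X : tfam) : Prop :=
  (forall i, vfholo (patch i V) (X i)) /\
  (forall i j, let S := patch i (V `&` dom j) in
    [/\ sfeq S (spull (trans i j) (vz (X j))) (vapp (X i) (mz (trans i j))),
        sfeq S (spull (trans i j) (v1 (X j))) (vapp (X i) (m1 (trans i j)))
      & sfeq S (spull (trans i j) (v2 (X j))) (vapp (X i) (m2 (trans i j)))]).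

Definition ofam0 : ofam := fun=> sconst (0 : C).
Definition tfam0 : tfam := fun=> vzero C.
Definition tfam_add (X Y : tfam) : tfam := fun i => X i +v Y i.
Definition tfam_mul (h : ofam) (X : tfam) : tfam := fun i => h i *v X i.
Definition tfam_square (X : tfam) : tfam := fun i => vsquare (X i).
Definition tfam_anticomm (X Y : tfam) : tfam := fun i => vanticomm (X i) (Y i).

Definition ofam_eq V (h k : ofam) := forall i, sfeq (patch i V) (h i) (k i).
Definition tfam_eq V (X Y : tfam) := forall i, vfeq (patch i V) (X i) (Y i).
Definition ofam_odd V (h : ofam) := forall i, sfodd (patch i V) (h i).
Definition tfam_odd V (X : tfam) := forall i, vfodd (patch i V) (X i).

(* [D V X] reads: X is a section of D over the open set V *)
Definition presub := set (space M) -> tfam -> Prop.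

Definition is_subsheaf (D : presub) : Prop :=
  [/\ forall V X, D V X -> open V /\ tsection V X,
      forall V X Y, D V X -> tfam_eq V X Y -> D V Y,
      forall V V' X, D V X -> open V' -> V' `<=` V -> D V' X,
      forall V, open V ->
        [/\ D V tfam0,
            forall X Y, D V X -> D V Y -> D V (tfam_add X Y)
          & forall h X, osection V h -> D V X -> D V (tfam_mul h X)]
    & forall V X, open V -> tsection V X ->
        (forall x, V x -> exists V', [/\ V' x, V' `<=` V & D V' X]) -> D V X].

(* the subsheaf of the tangent sheaf of W generated by a set of sections
   over W *)
Definition generated (W : set (space M)) (G : set tfam) : presub :=
  fun V X => [/\ open V, V `<=` W, tsection V X
    & forall x, V x -> exists V', [/\ open V', V' x, V' `<=` V
      & exists (n : nat) (h : 'I_n -> ofam) (s : 'I_n -> tfam),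
          (forall l, osection V' (h l) /\ G (s l)) /\
          tfam_eq V' X
            (\big[tfam_add/tfam0]_(l < n) tfam_mul (h l) (s l))]].

(* Y is odd and is a basis of D over V *)
Definition odd_generator (D : presub) V (Y : tfam) : Prop :=
  [/\ tfam_odd V Y, D V Y
    & forall V', open V' -> V' `<=` V ->
        (forall X, D V' X ->
           exists h, osection V' h /\ tfam_eq V' X (tfam_mul h Y)) /\
        (forall h, osection V' h -> tfam_eq V' (tfam_mul h Y) tfam0 ->
           ofam_eq V' h ofam0)].

(* locally free subsheaf of rank 0|1 *)
Definition invertible01 (D : presub) : Prop :=
  is_subsheaf D /\
  forall x, exists V, [/\ open V, V x & exists Y, odd_generator D V Y].

Definition integrable_on V (Y : tfam) : Prop :=
  exists f : ofam, [/\ osection V f, ofam_odd V f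
    & tfam_eq V (tfam_square Y) (tfam_mul f Y)].

Definition generates_tangent V (G : set tfam) : Prop :=
  forall V' X, open V' -> V' `<=` V -> tsection V' X -> generated V G V' X.

Definition N2_super_Riemann_surface (D1 D2 : presub) : Prop :=
  [/\ is_supermanifold, invertible01 D1, invertible01 D2
    & forall x, exists V (Y1 Y2 : tfam),
        [/\ open V /\ V x,
            odd_generator D1 V Y1 /\ odd_generator D2 V Y2,
            integrable_on V Y1 /\ integrable_on V Y2
          & generates_tangent V [set Y1; Y2; tfam_anticomm Y1 Y2]]].

End Supermanifolds.

(* [Some z] is the point with coordinate z, [None] the point w = 0 *)
Definition P1 (C : numClosedFieldType) := option C.

Section ProjectiveLine.
Variable C : numClosedFieldType.

HB.instance Definition _ := Choice.copy (P1 C) (option C).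

Definition P1_of_z (z : C) : P1 C := Some z.
Definition P1_of_w (w : C) : P1 C := if w == 0 then None else Some w^-1.

Definition P1_open (V : set (P1 C)) :=
  open (P1_of_z @^-1` V) /\ open (P1_of_w @^-1` V).

Let P1_openT : P1_open setT.
Proof. by split; rewrite preimage_setT; exact: openT. Qed.

Let P1_openI (A B : set (P1 C)) : P1_open A -> P1_open B -> P1_open (A `&` B).
Proof. by move=> [A0 A1] [B0 B1]; split; rewrite preimage_setI; exact: openI. Qed.

Let P1_open_bigU (I : Type) (f : I -> set (P1 C)) :
  (forall i, P1_open (f i)) -> P1_open (\bigcup_i f i).
Proof.
by move=> fo; split; rewrite preimage_bigcup; apply: bigcup_open => i _;
  case: (fo i).
Qed.

HB.instance Definition _ :=
  isOpenTopological.Build (P1 C) P1_openT P1_openI P1_open_bigU.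

Inductive P1_chart := zchart | wchart.

Definition P1_dom (i : P1_chart) : set (P1 C) :=
  match i with
  | zchart => [set x | x <> None]
  | wchart => [set x | x <> Some 0]
  end.

Definition P1_coord (i : P1_chart) (x : P1 C) : C :=
  match i, x with
  | zchart, Some z => z
  | zchart, None => 0
  | wchart, Some z => z^-1
  | wchart, None => 0
  end.

(* (z | theta_1, theta_2) |-> (1/z | theta_1/z, theta_2/z), which is its own
   inverse *)
Definition P12_inv : smap C :=
  SMap (fun z => gconst z^-1)
       (fun z => Grass 0 z^-1 0 0)
       (fun z => Grass 0 0 z^-1 0).

Definition P12_trans (i j : P1_chart) : smap C :=
  match i, j with
  | zchart, zchart | wchart, wchart => sid C
  | zchart, wchart | wchart, zchart => P12_inv
  end.

Definition P12 : superatlas C :=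
  @SuperAtlas C (P1 C) P1_chart P1_dom P1_coord P12_trans.

Local Notation z := (@szvar C).
Local Notation th1 := (@stheta1 C).
Local Notation th2 := (@stheta2 C).
Local Notation dz := (vdz C).
Local Notation d1 := (vd1 C).
Local Notation d2 := (vd2 C).
Local Notation c := (@sconst C).

Definition D1 (a1 a2 : C) : vfield C :=
  c a1 *v (d1 +v th2 *v dz)
  +v c a2 *v ((z *f th2) *v dz +v (c (-1) *f th1 *f th2) *v d1 +v z *v d1).

Definition D1_factored (a1 a2 : C) : vfield C :=
  (c a1 +f c a2 *f (z +f c (-1) *f th1 *f th2)) *v (d1 +v th2 *v dz).

Definition D2 (b1 b2 : C) : vfield C :=
  c b1 *v (d2 +v th1 *v dz)
  +v c b2 *v ((z *f th1) *v dz +v (th1 *f th2) *v d2 +v z *v d2).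

Definition D2_factored (b1 b2 : C) : vfield C :=
  (c b1 +f c b2 *f (z +f th1 *f th2)) *v (d2 +v th1 *v dz).

(* X is a global vector field whose expression in the chart z is Y *)
Definition extends_to (Y : vfield C) (X : tfam P12) : Prop :=
  tsection setT X /\ vfeq setT (X zchart) Y.

Definition calD1 : presub P12 :=
  generated setT [set X | exists a1 a2, extends_to (D1 a1 a2) X].
Definition calD2 : presub P12 :=
  generated setT [set X | exists b1 b2, extends_to (D2 b1 b2) X].

End ProjectiveLine.

(* Main.v *)
Require Import Defs.
From mathcomp Require Import all_boot all_order all_algebra.
From mathcomp Require Import all_classical all_reals all_analysis.
From mathcomp Require Import complex.
From HB Require Import structures.
From mathcomp Require Import ring.

Set Implicit Arguments.
Unset Strict Implicit.
Unset Printing Implicit Defensive.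

Import Order.TTheory GRing.Theory Num.Theory.
Import numFieldNormedType.Exports.

Local Open Scope classical_set_scope.
Local Open Scope ring_scope.

(** Why the theorem holds. Write [x] for the even coordinate of a chart and give
    the charts [z] and [w] the signs [s = 1] and [s = -1]. The field
    [E1 = d1 + s theta_2 dx] of one chart becomes, in the other chart,
    [(x + s theta_1 theta_2) (d1 - s theta_2 dx)]: a function times the field of
    the same shape with the opposite sign. The same holds for
    [E2 = d2 + s theta_1 dx] with the factor [x - s theta_1 theta_2]. So each
    chart [i] gives a global field [chart_generator k i] (with [k = false] for
    the first distribution and [k = true] for the second), and the fields of the
    statement are the constant combinations of the generators of the two charts
    (lemmas [D1E], [D2E], [extends_global_section]). On the domain of chart [i]
    the generator of the other chart is a multiple of the generator of chart
    [i], whose coefficient on [d1] (or [d2]) is 1. This makes it a basis of the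
    distribution there ([chart_generator_basis]). Both generators have square
    zero, and in chart [i] their anticommutator is [2 s dx], so together with it
    they span the tangent sheaf ([chart_generators_span]).

    Two facts turn this into computations in a single chart. The change of
    coordinates has no nilpotent part in its even component, so that pulling a
    function back only evaluates it at the transformed point and rescales the
    odd coordinates ([spullE]); since this rescaling is multiplicative
    ([twistM]), families of sections are stable under sums and products. And a
    section over a subset of the domain of a chart is determined by its
    expression in that chart ([tsection_determined], [osection_determined]),
    where functions can also be prescribed freely ([osection_extend]).

    Second countability of the projective line is deduced from that of the
    complex line, where the discs with Gaussian rational centres and rational
    radii form a base ([complex_second_countable]). *)

(** * The Grassmann algebra *)

Section GrassmannAlgebra.
Variable C : numClosedFieldType.
Implicit Types a b c : grass C.

Lemma gaddA : associative (@gadd C).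
Proof. by move=> [? ? ? ?] [? ? ? ?] [? ? ? ?]; congr Grass; exact: addrA. Qed.

Lemma gadd0 : left_id (gconst 0) (@gadd C).
Proof. by move=> [? ? ? ?]; congr Grass; exact: add0r. Qed.

Lemma gaddr0 : right_id (gconst 0) (@gadd C).
Proof. by move=> [? ? ? ?]; congr Grass; exact: addr0. Qed.

Lemma gmulA : associative (@gmul C).
Proof. by move=> [? ? ? ?] [? ? ? ?] [? ? ? ?]; congr Grass => /=; ring. Qed.

Lemma gmulDr a b c : gmul a (gadd b c) = gadd (gmul a b) (gmul a c).
Proof. by case: a b c => [? ? ? ?] [? ? ? ?] [? ? ? ?]; congr Grass => /=; ring. Qed.

Lemma gmulDl a b c : gmul (gadd a b) c = gadd (gmul a c) (gmul b c).
Proof. by case: a b c => [? ? ? ?] [? ? ? ?] [? ? ? ?]; congr Grass => /=; ring. Qed.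

Lemma gmul1 a : gmul (gconst 1) a = a.
Proof. by case: a => [? ? ? ?]; congr Grass => /=; ring. Qed.

Lemma gmulr1 a : gmul a (gconst 1) = a.
Proof. by case: a => [? ? ? ?]; congr Grass => /=; ring. Qed.

Lemma gmul0 a : gmul (gconst 0) a = gconst 0.
Proof. by case: a => [? ? ? ?]; congr Grass => /=; ring. Qed.

Lemma gmulr0 a : gmul a (gconst 0) = gconst 0.
Proof. by case: a => [? ? ? ?]; congr Grass => /=; ring. Qed.

(** The substitution [theta_i -> l theta_i]. *)
Definition twist (l : C) a := Grass (g0 a) (l * g1 a) (l * g2 a) (l ^+ 2 * g12 a).

Lemma twistD l a b : twist l (gadd a b) = gadd (twist l a) (twist l b).
Proof. by congr Grass => /=; ring. Qed.

Lemma twistM l a b : twist l (gmul a b) = gmul (twist l a) (twist l b).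
Proof. by congr Grass => /=; ring. Qed.

Lemma twist_gconst l (c : C) : twist l (gconst c) = gconst c.
Proof. by congr Grass => /=; ring. Qed.

Lemma twist1 a : twist 1 a = a.
Proof. by case: a => [? ? ? ?]; congr Grass => /=; ring. Qed.

Lemma twist_twist l l' a : twist l (twist l' a) = twist (l * l') a.
Proof. by congr Grass => /=; ring. Qed.

Lemma twist_inj l : l != 0 -> injective (twist l).
Proof.
move=> l0 a b /(congr1 (twist l^-1)).
by rewrite !twist_twist mulVf // !twist1.
Qed.

End GrassmannAlgebra.

(** * Holomorphic superfunctions *)

Section Holomorphy.
Variable C : numClosedFieldType.
Implicit Types (f g : superfun C) (S : set C) (u v : C -> C) (x : C).

Lemma derivable_add u v x : derivable u x 1 -> derivable v x 1 ->
  derivable (fun y : C => u y + v y) x 1.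
Proof. exact: derivableD. Qed.

Lemma derivable_sub u v x : derivable u x 1 -> derivable v x 1 ->
  derivable (fun y : C => u y - v y) x 1.
Proof. exact: derivableB. Qed.

Lemma derivable_mul u v x : derivable u x 1 -> derivable v x 1 ->
  derivable (fun y : C => u y * v y) x 1.
Proof. exact: derivableM. Qed.

Lemma derivable_const {c : C} {x} : derivable (fun=> c : C) x 1.
Proof. exact: derivable_cst. Qed.

Lemma derivable_inv x : x != 0 -> derivable (fun y : C => y^-1) x 1.
Proof. by move=> x0; apply: (@derivableV _ _ (id : C -> C)). Qed.

Lemma derivable_compinv u x : x != 0 -> derivable u x^-1 1 ->
  derivable (fun y : C => u y^-1) x 1.
Proof.
move=> x0 /derivable1_diffP du; apply/derivable1_diffP.
apply: (@differentiable_comp _ _ _ _ (fun y : C => y^-1) u) => //.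
by apply/derivable1_diffP/derivable_inv.
Qed.

Lemma derive1_const (c : C) x : derive1 (fun=> c : C) x = 0.
Proof. by rewrite derive1E (derive_cst c). Qed.

Lemma derive1_affine (a b : C) x : derive1 (fun y : C => a + b * y) x = b.
Proof.
rewrite derive1E deriveD; last 2 first.
- exact: derivable_cst.
- by apply: derivable_mul; [exact: derivable_const|exact: derivable_id].
rewrite (derive_cst a) add0r.
rewrite (deriveM (@derivable_const b x) (@derivable_id _ _ x 1)).
by rewrite derive_cst derive_id scaler0 addr0 /GRing.scale /= mulr1.
Qed.

Lemma derive1_inv x : x != 0 -> derive1 (fun y : C => y^-1) x = - x ^- 2.
Proof.
move=> x0; rewrite derive1E.
rewrite (@deriveV _ _ (id : C -> C) x 1 x0 (@derivable_id _ _ x 1)).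
by rewrite derive_id /GRing.scale /= mulr1.
Qed.

Lemma sfholoD S f g : sfholo S f -> sfholo S g -> sfholo S (f +f g).
Proof.
by move=> hf hg x /[dup] /hf[? ? ? ?] /hg[? ? ? ?]; split; exact: derivable_add.
Qed.

Lemma sfholoM S f g : sfholo S f -> sfholo S g -> sfholo S (f *f g).
Proof.
move=> hf hg x /[dup] /hf[? ? ? ?] /hg[? ? ? ?].
split; first exact: derivable_mul.
- by apply: derivable_add; exact: derivable_mul.
- by apply: derivable_add; exact: derivable_mul.
- by apply: derivable_sub; [apply: derivable_add; [apply: derivable_add|]|];
    exact: derivable_mul.
Qed.

Lemma sfholoS S S' f : S `<=` S' -> sfholo S' f -> sfholo S f.
Proof. by move=> sub hf x /sub /hf. Qed.

Lemma sfholo_eq S f g : open S -> sfeq S f g -> sfholo S f -> sfholo S g.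
Proof.
move=> oS fg hf x Sx; have [d0 d1 d2 d12] := hf _ Sx.
have nS : \forall y \near x, S y by exact: open_nbhs_nbhs.
have H (p : grass C -> C) : derivable (fun y : C => p (f y)) x 1 ->
    derivable (fun y : C => p (g y)) x 1.
  by apply: near_eq_derivable; near=> y; rewrite fg //; near: y.
by split; exact: H.
Unshelve. all: by end_near. Qed.

(** The components of the generating fields of the two distributions have this
    affine form in both charts, and [sdz_affine] differentiates them. *)
Definition saffine (a b : grass C) : superfun C := fun x =>
  Grass (g0 a + g0 b * x) (g1 a + g1 b * x) (g2 a + g2 b * x) (g12 a + g12 b * x).

Lemma sdz_affine a b : sdz (saffine a b) = (fun=> b).
Proof. by apply/funext => x; case: b => *; congr Grass; exact: derive1_affine. Qed.

Lemma sfholo_affine S a b : sfholo S (saffine a b).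
Proof.
have H (p q x : C) : derivable (fun y : C => p + q * y) x 1.
  by apply: derivable_add; [|apply: derivable_mul];
    [exact: derivable_const|exact: derivable_const|exact: derivable_id].
by move=> x _; split; exact: H.
Qed.

Lemma sfholo_const S (c : grass C) : sfholo S (fun=> c).
Proof. by move=> x _; split; exact: derivable_const. Qed.

End Holomorphy.

(** * The charts of the projective superline *)

Section Charts.
Variable C : numClosedFieldType.
Implicit Types (i j k : P1_chart) (x : C) (f g : superfun C).
Implicit Types V : set (P1 C).

Definition same_chart i j : bool :=
  match i, j with zchart, zchart | wchart, wchart => true | _, _ => false end.

(** Inverse of the coordinate of chart [i]. *)
Definition param i : C -> P1 C :=
  match i with zchart => @P1_of_z C | wchart => @P1_of_w C end.

(** [move_pt i j x] is the coordinate in chart [j] of the point with coordinate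
    [x] in chart [i], and [rescale i j x] is the factor by which the odd
    coordinates are multiplied there. *)
Definition move_pt i j x := if same_chart i j then x else x^-1.
Definition rescale i j x : C := if same_chart i j then 1 else x^-1.

Lemma param_dom i x : P1_dom i (param i x).
Proof.
case: i => //=; rewrite /P1_of_w; have [//|x0 [/eqP]] := eqVneq x 0.
by rewrite invr_eq0 (negbTE x0).
Qed.

Lemma paramK i : cancel (param i) (P1_coord i).
Proof.
case: i => // x /=; rewrite /P1_of_w; have [->//|x0] := eqVneq x 0.
by rewrite /= invrK.
Qed.

Lemma coordK i p : P1_dom i p -> param i (P1_coord i p) = p.
Proof.
case: i p => [] [z|] //= z0; rewrite /P1_of_w ?eqxx // invr_eq0 invrK.
by case: eqP => // z00; case: z0; rewrite z00.
Qed.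

Lemma param_inj i : injective (param i).
Proof. exact: can_inj (paramK i). Qed.

Lemma param_move i j x : same_chart i j || (x != 0) ->
  param j (move_pt i j x) = param i x.
Proof.
by case: i j => [] [] //= x0; rewrite /move_pt /= /P1_of_w ?invr_eq0 (negbTE x0) ?invrK.
Qed.

Lemma dom_param i j x : P1_dom j (param i x) -> same_chart i j || (x != 0).
Proof.
case: i j => [] [] //=; first by move=> h; apply/eqP => x0; apply: h; rewrite x0.
by rewrite /P1_of_w; case: eqP.
Qed.

Lemma param_dom_move i j x : P1_dom j (param i x) ->
  param j (move_pt i j x) = param i x.
Proof. by move/dom_param/param_move. Qed.

Lemma move_ptK i j : cancel (move_pt i j) (move_pt j i).
Proof. by case: i j => [] [] x; rewrite /move_pt //= invrK. Qed.

Lemma rescale_neq0 i j x : P1_dom j (param i x) -> rescale i j x != 0.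
Proof.
by move=> /dom_param; rewrite /rescale; case: same_chart => //=; rewrite ?oner_eq0 ?invr_eq0.
Qed.

(** Patches become preimages, which commute with all operations on open sets
    and do not mention the coordinate at points outside the chart. *)
Lemma patch_param i V : Defs.patch (M := P12 C) i V = param i @^-1` V.
Proof.
apply/seteqP; split=> [_ [p [Vp dp] <-]|x Vx] /=; first by rewrite coordK.
by exists (param i x); [split => //; exact: param_dom|exact: paramK].
Qed.

Lemma open_param i V : open V -> open (param i @^-1` V).
Proof. by case: i => [] []. Qed.

Lemma param_open V : (forall i, open (param i @^-1` V)) -> open V.
Proof. by move=> oV; split; [exact: (oV zchart)|exact: (oV wchart)]. Qed.

Lemma open_P1_dom i : open (@P1_dom C i).
Proof.
have oN : open [set x : C | x != 0].
  have -> : [set x : C | x != 0] = ~` [set 0].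
    by apply/seteqP; split=> x /eqP.
  apply: closed_openC; apply: accessible_closed_set1.
  exact: hausdorff_accessible (@norm_hausdorff C C).
apply: param_open => j.
have [ij|nij] := boolP (same_chart j i).
  suff -> : param j @^-1` P1_dom i = setT by exact: openT.
  have -> : i = j by case: i j ij => [] [].
  by apply/seteqP; split=> // x _; exact: param_dom.
suff -> : param j @^-1` P1_dom i = [set x : C | x != 0] by [].
apply/seteqP; split=> x; first by move/dom_param; rewrite (negbTE nij).
by move=> /= x0; rewrite -(@param_move j i x) ?x0 ?orbT //; exact: param_dom.
Qed.

(** The even component of every transition map is a number, so the derivative
    terms of the Taylor expansion are multiplied by 0. *)
Lemma spullE i j f x :
  spull (P12_trans C i j) f x = twist (rescale i j x) (f (move_pt i j x)).
Proof.
by case: i j => [] []; rewrite /spull /rescale /move_pt /twist /geval /=;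
  congr Grass => /=; ring.
Qed.

(** The components of a pulled-back superfunction are products of powers of
    [1/x] with functions composed with the inversion, and [x] is not 0 on an
    overlap. *)
Lemma sfholo_transport i j V f : V `<=` @P1_dom C i ->
  sfholo (param i @^-1` V) f ->
  sfholo (param j @^-1` V) (fun x => twist (rescale j i x) (f (move_pt j i x))).
Proof.
move=> Vi hf x Vx; have di := Vi _ Vx.
have : (param i @^-1` V) (move_pt j i x) by rewrite /= param_dom_move.
move/hf; rewrite /move_pt /rescale.
have := dom_param di; case: same_chart => /= x0 [d0 d1 d2 d12].
  split => /=; first exact: d0.
  - exact: (derivable_mul (derivable_const (c := 1)) d1).
  - exact: (derivable_mul (derivable_const (c := 1)) d2).
  - exact: (derivable_mul (derivable_const (c := 1 ^+ 2)) d12).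
have dl := derivable_inv x0.
split => /=; first exact: (derivable_compinv x0 d0).
- exact: (derivable_mul dl (derivable_compinv x0 d1)).
- exact: (derivable_mul dl (derivable_compinv x0 d2)).
- exact: (derivable_mul (derivable_mul dl dl) (derivable_compinv x0 d12)).
Qed.

End Charts.

(** * Vector fields and their families *)

Section VectorFieldAlgebra.
Variable C : numClosedFieldType.
Implicit Types (X Y : vfield C) (f g h : superfun C) (x : C).

Lemma vappD X Y f x : vapp (X +v Y) f x = gadd (vapp X f x) (vapp Y f x).
Proof. by rewrite /vapp /vadd /sadd /smul /= !gmulDl; congr Grass => /=; ring. Qed.

Lemma vappM h X f x : vapp (h *v X) f x = gmul (h x) (vapp X f x).
Proof. by rewrite /vapp /vmul /sadd /smul /= !gmulDr !gmulA. Qed.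

Lemma vapp0 f x : vapp (vzero C) f x = gconst 0.
Proof. by rewrite /vapp /vzero /sadd /smul /= !gmul0 !gadd0. Qed.

Lemma eq_vapp X Y f x : vz X x = vz Y x -> v1 X x = v1 Y x -> v2 X x = v2 Y x ->
  vapp X f x = vapp Y f x.
Proof. by rewrite /vapp /sadd /smul => -> -> ->. Qed.

End VectorFieldAlgebra.

Section Families.
Variable C : numClosedFieldType.
Local Notation M := (P12 C).
Implicit Types (X Y Z : tfam M) (h : ofam M).

Lemma tfam_addA : associative (@tfam_add C M).
Proof.
move=> X Y Z; apply/funext => i; rewrite /tfam_add /vadd /=.
by congr VField; apply/funext => x; exact: gaddA.
Qed.

Lemma tfam_add0 : left_id (@tfam0 C M) (@tfam_add C M).
Proof.
move=> X; apply/funext => i; rewrite /tfam_add /tfam0 /vadd /=.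
by case: (X i) => *; congr VField; apply/funext => x; exact: gadd0.
Qed.

Lemma tfam_addr0 : right_id (@tfam0 C M) (@tfam_add C M).
Proof.
move=> X; apply/funext => i; rewrite /tfam_add /tfam0 /vadd /=.
by case: (X i) => *; congr VField; apply/funext => x; exact: gaddr0.
Qed.

HB.instance Definition _ :=
  Monoid.isLaw.Build (tfam M) (@tfam0 C M) (@tfam_add C M)
    tfam_addA tfam_add0 tfam_addr0.

Lemma tfam_mulDr h : {morph @tfam_mul C M h : X Y / tfam_add X Y}.
Proof.
move=> X Y; apply/funext => i; rewrite /tfam_add /tfam_mul /vadd /vmul /=.
by congr VField; apply/funext => x; exact: gmulDr.
Qed.

Lemma tfam_mulr0 h : tfam_mul h (@tfam0 C M) = @tfam0 C M.
Proof.
apply/funext => i; rewrite /tfam0 /tfam_mul /vzero /vmul /=.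
by congr VField; apply/funext => x; exact: gmulr0.
Qed.

Lemma tfam_mulA h h' X :
  tfam_mul h (tfam_mul h' X) = tfam_mul (fun i => h i *f h' i) X.
Proof.
apply/funext => i; rewrite /tfam_mul /vmul /=.
by congr VField; apply/funext => x; exact: gmulA.
Qed.

Lemma tfam_mul1 X : tfam_mul (fun=> sconst 1) X = X.
Proof.
apply/funext => i; rewrite /tfam_mul /vmul /=.
by case: (X i) => *; congr VField; apply/funext => x; exact: gmul1.
Qed.

Lemma tfam_mul0 X : tfam_mul (@ofam0 C M) X = @tfam0 C M.
Proof.
apply/funext => i; rewrite /tfam_mul /vmul /=.
by case: (X i) => *; congr VField; apply/funext => x; exact: gmul0.
Qed.

End Families.

(** * Sections of the structure sheaf and of the tangent sheaf *)

Section Sections.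
Variable C : numClosedFieldType.
Local Notation M := (P12 C).
Implicit Types (i j : P1_chart) (x : C) (V : set (Defs.space M)).
Implicit Types (X Y Z : tfam M) (h : ofam M).

Lemma osectionP V h : osection V h <->
  (forall i, sfholo (param i @^-1` V) (h i)) /\
  (forall i j x, V (param i x) -> P1_dom j (param i x) ->
    twist (rescale i j x) (h j (move_pt i j x)) = h i x).
Proof.
split=> [[hh hc]|[hh hc]]; split=> i.
- by have := hh i; rewrite patch_param.
- by move=> j x Vx dx; rewrite -(hc i j) ?patch_param // spullE.
- by rewrite patch_param.
- by move=> j x; rewrite patch_param spullE => -[Vx dx]; exact: hc.
Qed.

(** The cocycle condition of a vector field at the point with coordinate [x] in
    chart [i]. *)
Definition compatible_at X i j x :=
  [/\ twist (rescale i j x) (vz (X j) (move_pt i j x))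
        = vapp (X i) (mz (P12_trans C i j)) x,
      twist (rescale i j x) (v1 (X j) (move_pt i j x))
        = vapp (X i) (m1 (P12_trans C i j)) x
    & twist (rescale i j x) (v2 (X j) (move_pt i j x))
        = vapp (X i) (m2 (P12_trans C i j)) x].

Lemma tsectionP V X : tsection V X <->
  (forall i, vfholo (param i @^-1` V) (X i)) /\
  (forall i j x, V (param i x) -> P1_dom j (param i x) -> compatible_at X i j x).
Proof.
split=> [[hX cX]|[hX cX]]; split=> i.
- by have := hX i; rewrite patch_param.
- move=> j x Vx dx; have [] := cX i j; rewrite patch_param => cz c1 c2.
  by split; [rewrite -cz|rewrite -c1|rewrite -c2]; rewrite ?spullE.
- by rewrite patch_param.
- by move=> j; split=> x; rewrite patch_param spullE => -[Vx dx]; have [] := cX i j x.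
Qed.

Lemma tfam_eqP V X Y : tfam_eq V X Y <->
  forall i x, V (param i x) ->
    [/\ vz (X i) x = vz (Y i) x, v1 (X i) x = v1 (Y i) x & v2 (X i) x = v2 (Y i) x].
Proof.
split=> [XY i x Vx|XY i].
  by have [] := XY i; rewrite patch_param => e0 e1 e2; split; [exact: e0|exact: e1|exact: e2].
by split=> x; rewrite patch_param => /XY[].
Qed.

Lemma tfam_eqS V V' X Y : V' `<=` V -> tfam_eq V X Y -> tfam_eq V' X Y.
Proof. by move=> sub /tfam_eqP XY; apply/tfam_eqP => i x /sub; exact: XY. Qed.

Lemma tfam_eq_sym V X Y : tfam_eq V X Y -> tfam_eq V Y X.
Proof. by move=> /tfam_eqP XY; apply/tfam_eqP => i x /XY[-> -> ->]. Qed.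

Lemma tfam_eq_trans V X Y Z : tfam_eq V X Y -> tfam_eq V Y Z -> tfam_eq V X Z.
Proof.
move=> /tfam_eqP XY /tfam_eqP YZ; apply/tfam_eqP => i x Vx.
by have [-> -> ->] := XY i x Vx; exact: YZ.
Qed.

Lemma tfam_eqD V X Y X' Y' : tfam_eq V X Y -> tfam_eq V X' Y' ->
  tfam_eq V (tfam_add X X') (tfam_add Y Y').
Proof.
move=> /tfam_eqP XY /tfam_eqP XY'; apply/tfam_eqP => i x Vx.
have [a b c] := XY i x Vx; have [a' b' c'] := XY' i x Vx.
by split; rewrite /= /sadd ?a ?b ?c ?a' ?b' ?c'.
Qed.

Lemma tfam_eqM V h X Y : tfam_eq V X Y -> tfam_eq V (tfam_mul h X) (tfam_mul h Y).
Proof.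
move=> /tfam_eqP XY; apply/tfam_eqP => i x Vx.
by have [a b c] := XY i x Vx; split; rewrite /= /smul ?a ?b ?c.
Qed.

Lemma osectionS V V' h : V' `<=` V -> osection V h -> osection V' h.
Proof.
move=> sub /osectionP[hh hc]; apply/osectionP; split=> [i|i j x /sub]; last exact: hc.
by apply: sfholoS (hh i) => x; exact: sub.
Qed.

Lemma osection_const V (c : C) : osection V ((fun=> sconst c) : ofam M).
Proof.
apply/osectionP; split=> [i|i j x _ _]; first exact: sfholo_const.
exact: twist_gconst.
Qed.

Lemma osectionM V h h' : osection V h -> osection V h' ->
  osection V ((fun i => h i *f h' i) : ofam M).
Proof.
move=> /osectionP[hh hc] /osectionP[hh' hc']; apply/osectionP.
split=> [i|i j x Vx dx]; first exact: sfholoM.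
by rewrite /smul twistM hc // hc'.
Qed.

Lemma tsectionS V V' X : V' `<=` V -> tsection V X -> tsection V' X.
Proof.
move=> sub /tsectionP[hX cX]; apply/tsectionP.
split=> [i|i j x /sub]; last exact: cX.
have [hz h1 h2] := hX i; have sub' : param i @^-1` V' `<=` param i @^-1` V.
  by move=> x; exact: sub.
by split; [exact: sfholoS sub' hz|exact: sfholoS sub' h1|exact: sfholoS sub' h2].
Qed.

Lemma tsection0 V : tsection V (@tfam0 C M).
Proof.
apply/tsectionP; split=> [i|i j x _ _]; first by split; exact: sfholo_const.
by rewrite /compatible_at !vapp0 /= /sconst !twist_gconst.
Qed.

Lemma tsectionD V X Y : tsection V X -> tsection V Y -> tsection V (tfam_add X Y).
Proof.
move=> /tsectionP[hX cX] /tsectionP[hY cY]; apply/tsectionP.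
split=> [i|i j x Vx dx].
  have [hz h1 h2] := hX i; have [hz' h1' h2'] := hY i.
  by split; [exact: sfholoD hz hz'|exact: sfholoD h1 h1'|exact: sfholoD h2 h2'].
have [ez e1 e2] := cX i j x Vx dx; have [ez' e1' e2'] := cY i j x Vx dx.
by split; rewrite vappD /= /sadd twistD ?ez ?e1 ?e2 ?ez' ?e1' ?e2'.
Qed.

Lemma tsectionM V h X : osection V h -> tsection V X -> tsection V (tfam_mul h X).
Proof.
move=> /osectionP[hh hc] /tsectionP[hX cX]; apply/tsectionP.
split=> [i|i j x Vx dx].
  have [hz h1 h2] := hX i.
  by split; [exact: sfholoM (hh i) hz|exact: sfholoM (hh i) h1
    |exact: sfholoM (hh i) h2].
have [ez e1 e2] := cX i j x Vx dx.
by split; rewrite vappM /= /smul twistM hc // ?ez ?e1 ?e2.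
Qed.

(** Openness of [V] is what allows derivatives to be transferred between families
    that agree on [V] only. *)
Lemma tsection_eq V X Y : open V -> tfam_eq V X Y -> tsection V X -> tsection V Y.
Proof.
move=> oV /tfam_eqP XY /tsectionP[hX cX]; apply/tsectionP.
split=> [i|i j x Vx dx].
  have oW := open_param (i := i) oV; have [hz h1 h2] := hX i.
  by split; [apply: (sfholo_eq oW _ hz)|apply: (sfholo_eq oW _ h1)
    |apply: (sfholo_eq oW _ h2)] => x /XY[].
have [ez e1 e2] := cX i j x Vx dx; have [a b c] := XY i x Vx.
have [|a' b' c'] := XY j (move_pt i j x); first by rewrite param_dom_move.
by split; rewrite -(eq_vapp _ a b c) -?a' -?b' -?c'.
Qed.

(** The cocycle condition expresses [X j] at a point through [X i] at the same
    point, without derivatives of [X i]. *)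
Lemma tsection_determined V X Y i : V `<=` @P1_dom C i ->
  tsection V X -> tsection V Y ->
  (forall x, V (param i x) ->
    [/\ vz (X i) x = vz (Y i) x, v1 (X i) x = v1 (Y i) x & v2 (X i) x = v2 (Y i) x]) ->
  tfam_eq V X Y.
Proof.
move=> Vi /tsectionP[_ cX] /tsectionP[_ cY] XY; apply/tfam_eqP => j x Vx.
have e : param i (move_pt j i x) = param j x by exact/param_dom_move/Vi.
set y := move_pt j i x in e.
have Vy : V (param i y) by rewrite e.
have dy : P1_dom j (param i y) by rewrite e; exact: param_dom.
have [a b c] := XY y Vy.
have [] := cX i j y Vy dy; have [] := cY i j y Vy dy.
rewrite !(eq_vapp _ a b c) {1 2 3 4 5 6}/y !move_ptK => <- <- <- ez e1 e2.
by split; apply: (twist_inj (rescale_neq0 dy)).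
Qed.

(** The section whose expression in chart [i] is [f]; it is one over the subsets
    of the domain of [i] only. *)
Definition extend i (f : superfun C) : ofam M :=
  fun j x => twist (rescale j i x) (f (move_pt j i x)).

Lemma extendE i f x : extend i f i x = f x.
Proof. by case: i; rewrite /extend /rescale /move_pt /= twist1. Qed.

(** On triple overlaps the rescaling factors multiply, which is the cocycle
    condition. *)
Lemma osection_extend i f V : V `<=` @P1_dom C i ->
  sfholo (param i @^-1` V) f -> osection V (extend i f).
Proof.
move=> Vi hf; apply/osectionP; split=> [j|j k x Vx dk].
  exact: sfholo_transport.
have := dom_param (Vi _ Vx); have := dom_param dk.
rewrite /extend twist_twist /rescale /move_pt.
case: i {Vi hf} j {Vx dk} k => [] [] [] //= x0 x0'; rewrite ?invrK ?mul1r ?mulr1 //;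
  by rewrite mulVf.
Qed.

Lemma osection_determined V i h : V `<=` @P1_dom C i -> osection V h ->
  (forall x, V (param i x) -> h i x = gconst 0) -> ofam_eq V h (@ofam0 C M).
Proof.
move=> Vi /osectionP[_ hc] h0 j x; rewrite patch_param => Vx.
rewrite -(hc j i) //; last exact: Vi.
by rewrite h0 ?twist_gconst // param_dom_move //; exact: Vi.
Qed.

(** A superfunction that is continuous at a point is determined there by its
    values elsewhere, since no point of the complex line is isolated. *)
Lemma sfholo_isolated (S : set C) (f g : superfun C) p :
  sfholo S f -> sfholo S g -> S p -> (forall x, x != p -> f x = g x) -> f p = g p.
Proof.
move=> hf hg Sp fg.
have H (q : grass C -> C) : derivable (fun x : C => q (f x)) p 1 ->
    derivable (fun x : C => q (g x)) p 1 -> q (f p) = q (g p).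
  move=> /derivable1_diffP/differentiable_continuous/continuous_withinNx cf.
  move=> /derivable1_diffP/differentiable_continuous/continuous_withinNx cg.
  apply: (cvg_unique (@norm_hausdorff C C) cf); apply: cvg_trans cg.
  by apply: near_eq_cvg; near=> x; rewrite fg //; near: x; exact: nbhs_dnbhs_neq.
have [f0 f1 f2 f12] := hf p Sp; have [g0' g1' g2' g12'] := hg p Sp.
move: (H _ f0 g0') (H _ f1 g1') (H _ f2 g2') (H _ f12 g12').
by case: (f p) (g p) => [? ? ? ?] [? ? ? ?] /= -> -> -> ->.
Unshelve. all: by end_near. Qed.

(** The chart [z] misses only the origin of chart [w], where continuity decides. *)
Lemma tsection_chart_unique X Y : tsection setT X -> tsection setT Y ->
  vfeq setT (X zchart) (Y zchart) -> tfam_eq setT X Y.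
Proof.
move=> sX sY [ez e1 e2].
have sub : [set p | P1_dom zchart p] `<=` [set: P1 C] by [].
have XY := tsection_determined (i := zchart) (fun _ => id) (tsectionS sub sX) (tsectionS sub sY).
have {XY} /tfam_eqP XY : tfam_eq (P1_dom zchart : set (Defs.space M)) X Y.
  by apply: XY => x _; split; [exact: ez|exact: e1|exact: e2].
have /tsectionP[/(_ wchart)[hz h1 h2] _] := sX.
have /tsectionP[/(_ wchart)[hz' h1' h2'] _] := sY.
have N x : x != 0 -> P1_dom zchart (param wchart x).
  by move=> x0; rewrite /= /P1_of_w (negbTE x0).
apply/tfam_eqP => -[] x _; first by split; [exact: ez|exact: e1|exact: e2].
have [->|x0] := eqVneq x 0; last exact: (XY wchart x (N x x0)).
by split; [apply: (sfholo_isolated hz hz')|apply: (sfholo_isolated h1 h1')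
  |apply: (sfholo_isolated h2 h2')] => // y /N/(XY wchart y)[].
Qed.

End Sections.

(** * The subsheaf generated by a set of fields *)

Section GeneratedSubsheaf.
Variable C : numClosedFieldType.
Local Notation M := (P12 C).
Implicit Types (V : set (Defs.space M)) (G : set (tfam M)) (X Y : tfam M).

(** The finite combinations, with coefficients defined on the whole of [V], that
    describe locally the sections of a generated subsheaf. *)
Definition combination G V X := exists (n : nat) (h : 'I_n -> ofam M) (s : 'I_n -> tfam M),
  (forall l, osection V (h l) /\ G (s l)) /\
  tfam_eq V X (\big[@tfam_add C M/@tfam0 C M]_(l < n) tfam_mul (h l) (s l)).

Lemma combinationS G V V' X : V' `<=` V -> combination G V X -> combination G V' X.
Proof.
move=> sub [n [h [s [hs XE]]]]; exists n, h, s; split; last exact: tfam_eqS XE.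
by move=> l; have [ho Gs] := hs l; split => //; exact: osectionS ho.
Qed.

Lemma combination_eq G V X Y : tfam_eq V X Y -> combination G V X -> combination G V Y.
Proof.
move=> XY [n [h [s [hs XE]]]]; exists n, h, s; split => //.
exact: tfam_eq_trans (tfam_eq_sym XY) XE.
Qed.

Lemma combination0 G V : combination G V (@tfam0 C M).
Proof.
exists 0%N, (fun=> @ofam0 C M), (fun=> @tfam0 C M); split; first by case.
by rewrite big_ord0; apply/tfam_eqP.
Qed.

Lemma combinationD G V X Y : combination G V X -> combination G V Y ->
  combination G V (tfam_add X Y).
Proof.
move=> [n [h [s [hs XE]]]] [n' [h' [s' [hs' YE]]]].
exists (n + n')%N, (fun l => match fintype.split l with inl a => h a | inr b => h' b end),
  (fun l => match fintype.split l with inl a => s a | inr b => s' b end).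
split=> [l|]; first by case: fintype.split.
set S := (X in tfam_eq V _ X).
have -> : S = tfam_add (\big[@tfam_add C M/@tfam0 C M]_(l < n) tfam_mul (h l) (s l))
                       (\big[@tfam_add C M/@tfam0 C M]_(l < n') tfam_mul (h' l) (s' l)).
  rewrite /S big_split_ord /=.
  congr tfam_add; apply: eq_bigr => l _; first by rewrite (unsplitK (inl l)).
  by rewrite (unsplitK (inr l)).
exact: tfam_eqD.
Qed.

Lemma combinationM G V h X : osection V h -> combination G V X ->
  combination G V (tfam_mul h X).
Proof.
move=> ho [n [k [s [hs XE]]]]; exists n, (fun l i => h i *f k l i), s.
split=> [l|]; first by have [ko Gs] := hs l; split => //; exact: osectionM.
under eq_bigr => l _ do rewrite -tfam_mulA.
rewrite -(big_morph _ (tfam_mulDr h) (tfam_mulr0 h)).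
exact: tfam_eqM.
Qed.

Lemma combination1 G V h X : osection V h -> G X -> combination G V (tfam_mul h X).
Proof.
move=> ho GX; exists 1%N, (fun=> h), (fun=> X); split=> //.
by rewrite big_ord_recl big_ord0 tfam_addr0; apply/tfam_eqP.
Qed.

Lemma generatedP G V X : generated setT G V X <->
  [/\ open V, tsection V X
    & forall x, V x -> exists V', [/\ open V', V' x, V' `<=` V & combination G V' X]].
Proof. by split=> [[oV _ sX loc]|[oV sX loc]]; split. Qed.

Lemma generated_subsheaf G : is_subsheaf (generated setT G).
Proof.
split.
- by move=> V X [oV _ sX _].
- move=> V X Y /generatedP[oV sX loc] XY; apply/generatedP.
  split=> //; first exact: tsection_eq sX.
  move=> p /loc[V' [oV' V'p sub cX]]; exists V'; split=> //.
  exact: combination_eq (tfam_eqS sub XY) cX.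
- move=> V V' X /generatedP[oV sX loc] oV' sub; apply/generatedP.
  split=> //; first exact: tsectionS sX.
  move=> p V'p; have [W [oW Wp WV cX]] := loc p (sub p V'p).
  exists (W `&` V'); split=> //; first exact: openI.
  by apply: combinationS cX; exact: subIsetl.
- move=> V oV; split.
  + apply/generatedP; split=> //; first exact: tsection0.
    by move=> p Vp; exists V; split=> //; exact: combination0.
  + move=> X Y /generatedP[_ sX lX] /generatedP[_ sY lY]; apply/generatedP.
    split=> //; first exact: tsectionD.
    move=> p Vp; have [W [oW Wp WV cX]] := lX p Vp.
    have [W' [oW' Wp' WV' cY]] := lY p Vp.
    exists (W `&` W'); split=> //; first exact: openI.
      by move=> q [/WV].
    by apply: combinationD; [apply: combinationS cX|apply: combinationS cY];
      [exact: subIsetl|exact: subIsetr].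
  + move=> h X ho /generatedP[_ sX lX]; apply/generatedP.
    split=> //; first exact: tsectionM.
    move=> p Vp; have [W [oW Wp WV cX]] := lX p Vp.
    exists W; split=> //; apply: combinationM => //; exact: osectionS ho.
- move=> V X oV sX loc; apply/generatedP; split=> // p /loc[W [Wp WV]].
  move=> /generatedP[_ _ /(_ p Wp)[W' [oW' Wp' WW' cX]]].
  by exists W'; split=> // q /WW' /WV.
Qed.

End GeneratedSubsheaf.

(** * The generator attached to a chart *)

Section Generators.
Variable C : numClosedFieldType.
Local Notation M := (P12 C).
Implicit Types (i j : P1_chart) (k : bool) (s x : C) (V : set (Defs.space M)).

Definition other_theta k s : grass C := if k then Grass 0 s 0 0 else Grass 0 0 s 0.

(** [d1 + s theta_2 dz] for [k = false] and [d2 + s theta_1 dz] for [k = true]. *)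
Definition superderivation k s : vfield C :=
  VField (fun=> other_theta k s) (sconst (~~ k)%:R) (sconst k%:R).

(** The function by which [superderivation k (- s)] has to be multiplied to give
    the expression of [superderivation k s] in the other chart. *)
Definition transition_factor k s : superfun C :=
  fun x => Grass x 0 0 (if k then - s else s).

Definition chart_sign i : C := match i with zchart => 1 | wchart => -1 end.

Definition chart_generator k i : tfam M := fun j =>
  if same_chart i j then superderivation k (chart_sign i)
  else transition_factor k (chart_sign i) *v superderivation k (chart_sign j).

(** The form in which the components can be differentiated by [sdz_affine]. *)
Lemma chart_generatorE k i j : chart_generator k i j =
  if same_chart i j then
    VField (saffine (other_theta k (chart_sign i)) (gconst 0))
           (saffine (gconst (~~ k)%:R) (gconst 0)) (saffine (gconst k%:R) (gconst 0))
  else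
    let c := Grass 0 0 0 (if k then - chart_sign i else chart_sign i) in
    VField (saffine (gconst 0) (other_theta k (chart_sign j)))
           (saffine (if k then gconst 0 else c) (gconst (~~ k)%:R))
           (saffine (if k then c else gconst 0) (gconst k%:R)).
Proof.
rewrite /chart_generator; case: same_chart; case: k; congr VField; apply/funext => x;
  rewrite /saffine /smul /gmul /sconst /gconst /=; congr Grass; ring.
Qed.

Lemma sdz_inv x : x != 0 -> sdz (mz (P12_inv C)) x = gconst (- x ^- 2).
Proof. by move=> x0; rewrite /sdz /= derive1_inv // derive1_const. Qed.

Lemma sdz_theta1_inv x : x != 0 -> sdz (m1 (P12_inv C)) x = Grass 0 (- x ^- 2) 0 0.
Proof. by move=> x0; rewrite /sdz /= derive1_inv // derive1_const. Qed.

Lemma sdz_theta2_inv x : x != 0 -> sdz (m2 (P12_inv C)) x = Grass 0 0 (- x ^- 2) 0.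
Proof. by move=> x0; rewrite /sdz /= derive1_inv // derive1_const. Qed.

Lemma sdz_szvar x : sdz (@szvar C) x = gconst 1.
Proof.
have -> : @szvar C = saffine (gconst 0) (gconst 1).
  by apply/funext => y; congr Grass => /=; ring.
by rewrite sdz_affine.
Qed.

Lemma sdz_sconst (c : grass C) x : sdz (fun=> c) x = gconst 0.
Proof. by rewrite /sdz /= !derive1_const. Qed.

Lemma compatible_same (X : tfam M) i x : compatible_at X i i x.
Proof.
rewrite /compatible_at /vapp /sadd /smul /rescale /move_pt /sd1 /sd2.
have -> : P12_trans C i i = sid C by case: i.
have -> : same_chart i i by case: i.
rewrite /= sdz_szvar !sdz_sconst !twist1 !gmulr0 !gmulr1 !gaddr0.
have -> : gd2 (szvar x) = gconst 0 by rewrite /gd2 /= oppr0.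
have -> : gd2 (stheta1 x) = gconst 0 by rewrite /gd2 /= oppr0.
have -> : gd2 (stheta2 x) = gconst 1 by rewrite /gd2 /= oppr0.
by rewrite !gmulr0 gmulr1 !gaddr0 !gadd0.
Qed.

(** The Jacobian of the inversion, which sends [(x | theta_1, theta_2)] to
    [(1/x | theta_1/x, theta_2/x)]. *)
Lemma compatible_inv (X : tfam M) i j x : same_chart i j = false -> x != 0 ->
  let Y := X j in let y := x^-1 in
  twist y (vz (Y) y) = gmul (vz (X i) x) (gconst (- y ^+ 2)) ->
  twist y (v1 (Y) y) = gadd (gmul (vz (X i) x) (Grass 0 (- y ^+ 2) 0 0))
    (gmul (v1 (X i) x) (gconst y)) ->
  twist y (v2 (Y) y) = gadd (gmul (vz (X i) x) (Grass 0 0 (- y ^+ 2) 0))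
    (gmul (v2 (X i) x) (gconst y)) ->
  compatible_at X i j x.
Proof.
move=> nij x0 /= ez e1 e2; rewrite /compatible_at /vapp /sadd /smul /rescale /move_pt nij.
have -> : P12_trans C i j = P12_inv C by case: i j nij {ez e1 e2} => [] [].
rewrite sdz_inv // sdz_theta1_inv // sdz_theta2_inv // ez e1 e2 /sd1 /sd2.
have g1E (a b : C) : gd1 (Grass a b 0 0) = gconst b by [].
have g2E (a b : C) : gd2 (Grass a 0 b 0) = gconst b by rewrite /gd2 /= oppr0.
have g1E' (a b : C) : gd1 (Grass a 0 b 0) = gconst 0 by [].
have g2E' (a b : C) : gd2 (Grass a b 0 0) = gconst 0 by rewrite /gd2 /= oppr0.
by rewrite /= g1E g2E' g1E g2E' g1E' g2E !gmulr0 !gaddr0 -exprVn.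
Qed.

(** The identity behind the whole construction: [transition_factor] relates the
    fields of the two charts. It is checked in both directions on the overlap,
    where the coordinate is invertible. *)
Lemma tsection_chart_generator V k i : tsection V (chart_generator k i).
Proof.
apply/tsectionP; split=> [j|j j' x _ dx].
  by rewrite chart_generatorE; case: same_chart; split; exact: sfholo_affine.
have := dom_param dx; have [e _|nij /= x0] := boolP (same_chart j j').
  have -> : j' = j by case: j j' e {dx} => [] [].
  exact: compatible_same.
apply: compatible_inv => //; first exact: negbTE.
all: case: k i j j' nij {dx} => [] [] [] [] //= _; congr Grass => /=; field => //.
Qed.

End Generators.

(** * The two distributions *)

Section StructureDistributions.
Variable C : numClosedFieldType.
Local Notation M := (P12 C).
Implicit Types (i j : P1_chart) (k : bool) (s x a b : C) (V : set (Defs.space M)).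

Definition Dk k a b : vfield C := if k then D2 a b else D1 a b.

Definition calDk k : presub M :=
  generated setT [set X | exists a b, extends_to (Dk k a b) X].

Definition global_section k a b : tfam M :=
  tfam_add (tfam_mul (fun=> sconst a) (chart_generator k zchart))
           (tfam_mul (fun=> sconst b) (chart_generator k wchart)).

Lemma vmulDl (f g : superfun C) (X : vfield C) : (f +f g) *v X = f *v X +v g *v X.
Proof. by congr VField; apply/funext => x; exact: gmulDl. Qed.

Lemma vmulA (f g : superfun C) (X : vfield C) : (f *f g) *v X = f *v (g *v X).
Proof. by congr VField; apply/funext => x; rewrite /= /smul gmulA. Qed.

Ltac superfield := congr VField; apply/funext => x;
  rewrite /sadd /smul /gadd /gmul /=; congr Grass; ring.

(** In the chart [z] the generator of chart [w] is the superderivation times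
    [transition_factor k (-1)], that is [z - theta_1 theta_2] for the first
    distribution and [z + theta_1 theta_2] for the second. *)
Lemma D1E a b : D1 a b = sconst a *v superderivation false 1
  +v sconst b *v (transition_factor false (-1) *v superderivation false 1).
Proof. by rewrite /D1; congr (_ *v _ +v _ *v _); superfield. Qed.

Lemma D2E a b : D2 a b = sconst a *v superderivation true 1
  +v sconst b *v (transition_factor true (-1) *v superderivation true 1).
Proof. by rewrite /D2; congr (_ *v _ +v _ *v _); superfield. Qed.

Lemma D1_factoredE a b : D1 a b = D1_factored a b.
Proof.
rewrite D1E -vmulA -vmulDl; congr ((_ +f _ *f _) *v _); last superfield.
apply/funext => x; congr Grass => /=; ring.
Qed.

Lemma D2_factoredE a b : D2 a b = D2_factored a b.
Proof.
rewrite D2E -vmulA -vmulDl; congr ((_ +f _ *f _) *v _); last superfield.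
apply/funext => x; congr Grass => /=; ring.
Qed.

Lemma extends_global_section k a b : extends_to (Dk k a b) (global_section k a b).
Proof.
split.
  by apply: tsectionD; apply: tsectionM;
    [exact: osection_const|exact: tsection_chart_generator
    |exact: osection_const|exact: tsection_chart_generator].
by rewrite /Dk; case: k; rewrite ?D1E ?D2E.
Qed.

Lemma global_section_z k : global_section k 1 0 = chart_generator k zchart.
Proof. by rewrite /global_section tfam_mul1 (tfam_mul0 _) tfam_addr0. Qed.

Lemma global_section_w k : global_section k 0 1 = chart_generator k wchart.
Proof. by rewrite /global_section tfam_mul1 (tfam_mul0 _) tfam_add0. Qed.

Lemma calDk_chart_generator k i V : open V -> calDk k V (chart_generator k i).
Proof.
move=> oV; apply/generatedP; split=> //; first exact: tsection_chart_generator.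
move=> p Vp; exists V; split=> //; rewrite -[chart_generator _ _]tfam_mul1.
apply: combination1; first exact: osection_const.
case: i; [rewrite -global_section_z; exists 1, 0|rewrite -global_section_w; exists 0, 1];
  exact: extends_global_section.
Qed.

(** Proportionality to the generator of chart [i] at a single point; working
    pointwise avoids patching together the factors of local combinations. *)
Definition on_line k i x (X : tfam M) := exists g : grass C,
  [/\ vz (X i) x = gmul g (other_theta k (chart_sign C i)),
      v1 (X i) x = gmul g (gconst (~~ k)%:R) & v2 (X i) x = gmul g (gconst k%:R)].

Lemma on_line_mul k i x h X : on_line k i x X -> on_line k i x (tfam_mul h X).
Proof.
move=> [g [e0 e1 e2]]; exists (gmul (h i x) g).
by rewrite /= /smul e0 e1 e2 !gmulA.
Qed.

Lemma on_line_add k i x X Y : on_line k i x X -> on_line k i x Y ->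
  on_line k i x (tfam_add X Y).
Proof.
move=> [g [e0 e1 e2]] [g' [e0' e1' e2']]; exists (gadd g g').
by rewrite /= /sadd e0 e1 e2 e0' e1' e2' !gmulDl.
Qed.

Lemma on_line_chart_generator k i j x : on_line k i x (chart_generator k j).
Proof.
rewrite /on_line /chart_generator; case: ifP => [e|_].
  have -> : j = i by case: j i e => [] [].
  by exists (gconst 1); rewrite !gmul1.
by exists (transition_factor k (chart_sign C j) x).
Qed.

(** The fields that generate the distribution are determined by their expression
    in the chart [z], hence are constant combinations of the two chart
    generators, and each of these is a multiple of the generator of chart [i]. *)
Lemma calDk_on_line k V X i x : calDk k V X -> V (param i x) -> on_line k i x X.
Proof.
move=> /generatedP[_ _ loc] /loc[W [_ Wx _ [n [h [t [ht XE]]]]]].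
have /tfam_eqP/(_ i x Wx)[e0 e1 e2] := XE.
suff : on_line k i x (\big[@tfam_add C M/@tfam0 C M]_(l < n) tfam_mul (h l) (t l)).
  by rewrite /on_line e0 e1 e2.
apply: (big_ind (on_line k i x)).
- by exists (gconst 0); rewrite !gmul0.
- exact: on_line_add.
move=> l _; apply: on_line_mul.
have [_ [a [b [st et]]]] := ht l.
have [sg eg] := extends_global_section k a b.
have : tfam_eq setT (t l) (global_section k a b).
  apply: tsection_chart_unique => //; case: et => e e' e''; case: eg => f f' f''.
  by split=> y Sy; [rewrite e ?f|rewrite e' ?f'|rewrite e'' ?f''].
move=> /tfam_eqP/(_ i x I)[f0 f1 f2].
have : on_line k i x (global_section k a b).
  by apply: on_line_add; apply: on_line_mul; exact: on_line_chart_generator.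
by rewrite /on_line f0 f1 f2.
Qed.

Lemma chart_generator_odd k i V : tfam_odd V (chart_generator k i).
Proof.
move=> j; rewrite /vfodd chart_generatorE.
by case: k i j => [] [] [] /=; split=> x _; split; rewrite /= ?(mul0r, addr0).
Qed.

Lemma chart_generator_self k i : chart_generator k i i = superderivation k (chart_sign C i).
Proof. by case: i. Qed.

(** The generator has coefficient 1 on [d1] or [d2], according to [k], so the
    factor of a section [X] over it is the coefficient of [X] there: this gives
    both its existence, globally and holomorphically, and its uniqueness. *)
Lemma chart_generator_basis k i :
  odd_generator (calDk k) (P1_dom i : set (Defs.space M)) (chart_generator k i).
Proof.
pose vk (Z : vfield C) := if k then v2 Z else v1 Z.
split.
- exact: chart_generator_odd.
- by apply: calDk_chart_generator; exact: open_P1_dom.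
move=> V oV Vi; split=> [X DX|h ho h0].
  have /generatedP[_ sX _] := DX.
  have /tsectionP[/(_ i)[_ hX1 hX2] _] := sX.
  have ho : osection V (extend i (vk (X i))).
    by apply: (osection_extend Vi); rewrite /vk; case: k {DX vk}; [exact: hX2|exact: hX1].
  exists (extend i (vk (X i))); split=> //.
  apply: (tsection_determined Vi) => // [|x Vx].
    by apply: tsectionM => //; exact: tsection_chart_generator.
  rewrite /= chart_generator_self /= /smul extendE /vk.
  have [g []] := calDk_on_line DX Vx.
  by case: k {DX vk ho} => /= -> -> ->; rewrite !gmulr0 !gmulr1.
apply: (osection_determined Vi) => // x Vx.
move: h0 => /tfam_eqP/(_ i x Vx)[_]; rewrite /= chart_generator_self /= /smul.
by case: k {vk}; rewrite /sconst ?gmulr1 => ? ?.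
Qed.

End StructureDistributions.

(** * Integrability and the anticommutator *)

Section Nondegeneracy.
Variable C : numClosedFieldType.
Local Notation M := (P12 C).
Implicit Types (i j : P1_chart) (k : bool) (s x : C) (V : set (Defs.space M)).

Lemma vsquare_chart_generator k i j : vsquare (chart_generator (C := C) k i j) = vzero C.
Proof.
rewrite chart_generatorE; case: k i j => [] [] [] /=;
  rewrite /vsquare /vapp /sadd /smul /sd1 /sd2 /= !sdz_affine;
  congr VField; apply/funext => x; rewrite /gadd /gmul /=; congr Grass; ring.
Qed.

Lemma chart_generator_integrable V k i : integrable_on V (chart_generator (C := C) k i).
Proof.
exists (@ofam0 C M); split; first exact: osection_const.
  by move=> j x _.
apply/tfam_eqP => j x _; rewrite /tfam_square vsquare_chart_generator.
by rewrite tfam_mul0.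
Qed.

(** The derivation with respect to the even coordinate of chart [i]; in the other
    chart it is [- x^2 dx - x theta_1 d1 - x theta_2 d2]. *)
Definition coordinate_field i : tfam M := fun j =>
  if same_chart i j then VField (sconst 1) (sconst 0) (sconst 0)
  else VField (fun x => gconst (- x ^+ 2)) (fun x => Grass 0 (- x) 0 0)
              (fun x => Grass 0 0 (- x) 0).

Lemma anticomm_chart_generator i :
  tfam_anticomm (chart_generator false i) (chart_generator true i) =
  tfam_mul (fun=> sconst (2 * chart_sign C i)) (coordinate_field i).
Proof.
apply/funext => j; rewrite /tfam_anticomm /tfam_mul !chart_generatorE.
case: i j => [] [] /=;
  rewrite /vanticomm /vapp /vmul /sadd /smul /sd1 /sd2 /= !sdz_affine;
  congr VField; apply/funext => x; rewrite /gadd /gmul /=; congr Grass; ring.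
Qed.

Lemma tsection_coordinate_field V i : tsection V (coordinate_field i).
Proof.
apply/tsectionP; split=> [j|j j' x _ dx].
  have dN (x : C) : derivable (fun y : C => - y) x 1.
    exact: (derivableN (@derivable_id _ _ x 1)).
  have dN2 (x : C) : derivable (fun y : C => - y ^+ 2) x 1.
    exact: (derivableN (derivable_mul (@derivable_id _ _ x 1) (@derivable_id _ _ x 1))).
  have dc (c x : C) : derivable (fun=> c : C) x 1 by exact: derivable_const.
  rewrite /coordinate_field; case: same_chart; first by split; exact: sfholo_const.
  split=> x _.
  - by split; [exact: dN2|exact: dc|exact: dc|exact: dc].
  - by split; [exact: dc|exact: dN|exact: dc|exact: dc].
  - by split; [exact: dc|exact: dc|exact: dN|exact: dc].
have := dom_param dx; have [e _|nij /= x0] := boolP (same_chart j j').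
  have -> : j' = j by case: j j' e {dx} => [] [].
  exact: compatible_same.
apply: compatible_inv => //; first exact: negbTE.
all: case: i j j' nij {dx} => [] [] [] //= _; congr Grass => /=; field => //.
Qed.

(** Cancellation of the contribution [a] of the two odd generators to the
    coefficient of the even derivation. *)
Lemma solve_for_dz (c : C) (a b : grass C) : c != 0 ->
  gadd a (gmul (gmul (gconst c^-1) (gadd b (gmul (gconst (-1)) a))) (gconst c)) = b.
Proof.
by move=> c0; case: a b => [? ? ? ?] [? ? ? ?]; congr Grass => /=; field.
Qed.

(** In chart [i] the matrix of the three fields is triangular, with diagonal
    [1, 1, 2 s]: the odd coefficients of [X] are its first two factors, and the
    third one is solved from the coefficient of the even derivation. *)
Lemma chart_generators_span i :
  generates_tangent (P1_dom i : set (Defs.space M))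
    [set chart_generator false i; chart_generator true i;
         tfam_anticomm (chart_generator false i) (chart_generator true i)].
Proof.
move=> V X oV Vi sX; split=> // p Vp; exists V; split=> //.
have /tsectionP[/(_ i)[hz h1 h2] _] := sX.
set Y1 := chart_generator false i; set Y2 := chart_generator true i.
set Y3 := tfam_anticomm Y1 Y2.
pose s := chart_sign C i.
(* the factor of [2 s dx] that is left once the odd generators are removed *)
pose f3 : superfun C := sconst (2 * s)^-1 *f (vz (X i) +f
  sconst (-1) *f (v1 (X i) *f (fun=> Grass 0 0 s 0) +f v2 (X i) *f (fun=> Grass 0 s 0 0))).
have o1 := osection_extend Vi h1.
have o2 := osection_extend Vi h2.
have o3 : osection V (extend i f3).
  apply: (osection_extend Vi); apply: sfholoM; first exact: sfholo_const.
  apply: (sfholoD hz); apply: sfholoM; first exact: sfholo_const.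
  apply: sfholoD; [apply: (sfholoM h1)|apply: (sfholoM h2)]; exact: sfholo_const.
have : combination [set Y1; Y2; Y3] V (tfam_add (tfam_mul (extend i (v1 (X i))) Y1)
    (tfam_add (tfam_mul (extend i (v2 (X i))) Y2) (tfam_mul (extend i f3) Y3))).
  apply: combinationD; first by apply: (combination1 o1); left; left.
  apply: combinationD; first by apply: (combination1 o2); left; right.
  by apply: (combination1 o3); right.
apply: combination_eq; apply: (tsection_determined Vi) => // [|x Vx].
  have sY k : tsection V (chart_generator (C := C) k i) by exact: tsection_chart_generator.
  apply: tsectionD; first exact: (tsectionM o1 (sY false)).
  apply: tsectionD; first exact: (tsectionM o2 (sY true)).
  apply: (tsectionM o3); rewrite /Y3 anticomm_chart_generator.
  by apply: tsectionM; [exact: osection_const|exact: tsection_coordinate_field].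
rewrite /Y3 anticomm_chart_generator /tfam_add /tfam_mul /= /Y1 /Y2 !chart_generator_self.
rewrite /sadd /smul /= !extendE /f3 /coordinate_field.
have -> : same_chart i i by case: i {Vi hz h1 h2 Y1 Y2 Y3 s f3 o1 o2 o3 Vx}.
have n0 : 2 * s != 0.
  by rewrite mulf_neq0 ?pnatr_eq0 // /s; case: (i); rewrite ?oppr_eq0 oner_eq0.
rewrite /= /sconst /other_theta /sadd /smul !gmulr0 !gmulr1 !gaddr0 !gadd0.
by split=> //; rewrite gaddA solve_for_dz.
Qed.

End Nondegeneracy.

(** * The projective superline as a supermanifold *)

Section ProjectiveLineTopology.
Variable C : numClosedFieldType.
Local Notation M := (P12 C).
Implicit Types (i j : P1_chart) (x : C) (p q : P1 C).

Lemma P1_param p : exists i x, p = param i x.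
Proof.
case: p => [z|]; first by exists zchart, z.
by exists wchart, 0; rewrite /= /P1_of_w eqxx.
Qed.

(** Charts are open maps: seen from the other chart, the image of [A] is the
    preimage of [A] under inversion, which is continuous away from 0. *)
Lemma open_param_image i (A : set C) : open A -> open (param i @` A).
Proof.
move=> oA; apply: param_open => j.
have [ij|nij] := boolP (same_chart j i).
  have -> : i = j by case: i j ij => [] [].
  suff -> : param j @^-1` (param j @` A) = A by [].
  by apply/seteqP; split=> [x [y Ay /param_inj <-]|x Ax] //; exists x.
suff -> : param j @^-1` (param i @` A) = [set x | x != 0 /\ A x^-1].
  rewrite openE => x [x0 Ax]; rewrite /interior.
  have nA : \forall y \near x, A y^-1.
    by apply: (inv_continuous x0); exact: open_nbhs_nbhs.
  have n0 : \forall y \near x, y != 0.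
    have := open_param (i := j) (open_P1_dom C i).
    rewrite openE => /(_ x) H; have /H : (param j @^-1` P1_dom i) x.
      by rewrite /= -(@param_move C j i x) ?x0 ?orbT //; exact: param_dom.
    by apply: filterS => y /dom_param; rewrite (negbTE nij).
  by near=> y; split; near: y.
apply/seteqP; split=> x.
  move=> [y Ay yx]; have dx : P1_dom i (param j x) by rewrite -yx; exact: param_dom.
  have x0 := dom_param dx; rewrite (negbTE nij) /= in x0; split=> //.
  move: yx; rewrite -(param_dom_move dx) /move_pt (negbTE nij).
  by move/param_inj <-.
move=> [x0 Ax]; exists x^-1 => //.
by have := @param_move C j i x; rewrite x0 orbT /move_pt (negbTE nij); apply.
Unshelve. all: by end_near. Qed.

Definition separated p q := exists U V : set (P1 C),
  [/\ open U, open V, U p, V q & U `&` V = set0].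

Lemma separated_sym p q : separated p q -> separated q p.
Proof. by move=> [U [V [oU oV Up Vq UV]]]; exists V, U; rewrite setIC. Qed.

Lemma separated_chart i p q : P1_dom i p -> P1_dom i q -> p <> q -> separated p q.
Proof.
move=> /coordK <- /coordK <-; set x := P1_coord i p; set y := P1_coord i q => pq.
have := @norm_hausdorff C C; rewrite open_hausdorff => /(_ x y).
case; first by apply/eqP => xy; apply: pq; rewrite xy.
move=> [A B] /= [/set_mem Ax /set_mem By] [oA oB /eqP AB].
exists (param i @` A), (param i @` B); split; do ?exact: open_param_image.
- by exists x.
- by exists y.
apply/seteqP; split=> // _ [[a Aa <-] [b Bb /param_inj ba]].
by have : (A `&` B) a; [split=> //; rewrite -ba|rewrite AB].
Qed.

(** The origins of the two charts are separated by their unit discs, because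
    the product of the two coordinates of a point is 1. *)
Lemma separated_0oo : separated (param zchart 0) (param wchart 0).
Proof.
have oD : open [set x : C | `|x| < 1].
  suff -> : [set x : C | `|x| < 1] = ball (0 : C) 1 by exact: ball_open.
  by rewrite -ball_normE; apply/seteqP; split=> x /=; rewrite sub0r normrN.
exists (param zchart @` [set x | `|x| < 1]), (param wchart @` [set x | `|x| < 1]).
split; do ?exact: open_param_image.
- by exists 0 => //=; rewrite normr0.
- by exists 0 => //=; rewrite normr0.
apply/seteqP; split=> // _ [[x /= x1 <-] [y /= y1]].
rewrite /P1_of_w; have [//|y0 [yx]] := eqVneq y 0.
have : `|x| * `|y| < 1 by rewrite -[ltRHS]mulr1; exact: ltr_pM.
by rewrite -normrM -yx mulVf // normr1 ltxx.
Qed.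

(** Any two points lie in a common chart, except the two origins. *)
Lemma P1_hausdorff : hausdorff_space (P1 C).
Proof.
suff sep p q : p <> q -> separated p q.
  rewrite open_hausdorff => p q /eqP/sep[U [V [oU oV Up Vq UV]]].
  by exists (U, V); split=> //=; [exact: mem_set|exact: mem_set|exact/eqP].
case: p q => [x|] [y|] pq //.
- exact: (@separated_chart zchart).
- have [->|x0] := eqVneq x 0.
    by have := separated_0oo; rewrite /= /P1_of_w eqxx.
  by apply: (@separated_chart wchart) => //= -[/eqP]; rewrite (negbTE x0).
- apply: separated_sym; have [->|x0] := eqVneq y 0.
    by have := separated_0oo; rewrite /= /P1_of_w eqxx.
  by apply: (@separated_chart wchart) => //= -[/eqP]; rewrite (negbTE x0).
Qed.

Lemma P1_second_countable :
  second_countable (T := C) -> second_countable (T := P1 C).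
Proof.
move=> [B cB [oB bB]].
exists ((image B (image^~ (param zchart))) `|` (image B (image^~ (param wchart)))).
  rewrite -bigcup2E; apply: bigcup_countable => // -[|[|n]] _ /=; last exact: countable0.
  - exact: card_le_trans (card_image_le _ _) cB.
  - exact: card_le_trans (card_image_le _ _) cB.
split.
  by move=> U [] [A BA <-]; apply: open_param_image; exact: oB.
move=> p N; rewrite nbhsE => -[W [oW Wp] WN].
have [i [x px]] := P1_param p.
have : nbhs x (param i @^-1` W).
  by apply: open_nbhs_nbhs; split; [exact: open_param|rewrite /= -px].
move=> /bB[A [BA Ax] AW]; exists (param i @` A).
  by split; [case: (i); [left|right]; exists A|exists x].
by move=> _ [y Ay <-]; apply: WN; exact: AW.
Qed.

Definition smap_holo (S : set C) (F : smap C) :=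
  [/\ sfholo S (mz F), sfholo S (m1 F) & sfholo S (m2 F)].

Lemma sfholo_sid S : smap_holo S (sid C).
Proof.
split; [|exact: sfholo_const|exact: sfholo_const] => x _.
have dc (c : C) : derivable (fun=> c : C) x 1 by exact: derivable_const.
by split; [exact: derivable_id|exact: dc|exact: dc|exact: dc].
Qed.

Lemma sfholo_inv (S : set C) : (forall x, S x -> x != 0) -> smap_holo S (P12_inv C).
Proof.
move=> S0; split=> x /S0/derivable_inv dx;
  have dc (c : C) : derivable (fun=> c : C) x 1 by exact: derivable_const.
- by split; [exact: dx|exact: dc|exact: dc|exact: dc].
- by split; [exact: dc|exact: dx|exact: dc|exact: dc].
- by split; [exact: dc|exact: dc|exact: dx|exact: dc].
Qed.

Lemma P12_supermanifold :
  second_countable (T := C) -> is_supermanifold M.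
Proof.
move=> scC; split.
- by split; [exact: P1_hausdorff|exact: P1_second_countable].
- by move=> p; have [i [x ->]] := P1_param p; exists i; exact: param_dom.
- move=> i; split; first exact: open_P1_dom.
    move=> p q /set_mem dp /set_mem dq pq.
    by rewrite -(coordK dp) -(coordK dq); congr param.
  move=> V Vi.
  have -> : Defs.coord (s := M) i @` V = param i @^-1` V.
    by rewrite -patch_param /Defs.patch; congr image; exact/esym/setIidPl.
  split; first exact: open_param.
  suff {2}-> : V = param i @` (param i @^-1` V) by exact: open_param_image.
  apply/seteqP; split=> [p Vp|_ [x Vx <-]] //.
  by exists (P1_coord i p); rewrite /= coordK //; exact: Vi.
- move=> i j S; split.
  + have S0 : same_chart i j = false -> forall x, S x -> x != 0.
      by move=> nij x; rewrite /S patch_param => /dom_param; rewrite nij.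
    by case: i j @S S0 => [] [] S S0; [exact: sfholo_sid|apply: sfholo_inv; exact: S0
      |apply: sfholo_inv; exact: S0|exact: sfholo_sid].
  + by case: i j @S => [] [] S; split=> x _; split; rewrite /= ?oppr0.
  + by case: i j @S => [] [] _ [x|] //= _ _; rewrite ?invrK ?invr0.
split=> [i|i j k] S; first by case: i @S => S; split.
split=> x; rewrite /S patch_param /= => -[/dom_param + /dom_param +];
  rewrite /trans /= spullE /rescale /move_pt;
  case: i j k @S => [] [] [] _ //= x0 x0'; rewrite ?twist1 //;
  by congr Grass; rewrite /= ?invrK ?mulr0 ?mulr1 ?mulVf.
Qed.

End ProjectiveLineTopology.

(** * Second countability of the complex line *)

Section ComplexNumbers.
Variable R : realType.
Local Notation C := (Cx R).

Lemma normc_real (a : R) : `|(a%:C)%C : C| = (`|a|%:C)%C.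
Proof. by rewrite normc_def /= expr0n addr0 sqrtr_sqr. Qed.

Lemma ltr_natSinv (e : C) : 0 < e -> exists n, n.+1%:R^-1 < e.
Proof.
case: e => a b; rewrite ltcE /= => /andP[/eqP b0 a0].
have [n] := ltr_add_invr a0; rewrite add0r => na; exists n.
have -> : (n.+1%:R^-1 : C) = ((n.+1%:R^-1 : R)%:C)%C by rewrite fmorphV rmorph_nat.
by rewrite ltcE /= b0 eqxx.
Qed.

Lemma norm_complex_le (a b : R) : `|(Complex a b : C)| <= ((`|a| + `|b|)%:C)%C.
Proof.
rewrite [Complex a b]complexE /=; apply: le_trans (ler_normD _ _) _.
rewrite normrM !normc_real rmorphD lerD2l.
by rewrite normc_def /= expr0n add0r expr1n sqrtr1 mul1r.
Qed.

Lemma rational_near (a e : R) : 0 < e -> exists q : rat, `|a - ratr q| < e.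
Proof.
move=> e0; have [|q] := @rat_in_itvoo R (a - e) (a + e).
  by rewrite ltrD2l (lt_trans _ e0) // oppr_lt0.
by rewrite in_itv /= => /andP[aq qa]; exists q; rewrite distrC ltr_distl aq.
Qed.

Lemma rational_dense (x : C) (n : nat) :
  exists q : rat * rat, `|x - Complex (ratr q.1) (ratr q.2)| < n.+1%:R^-1.
Proof.
case: x => a b.
have e0 : 0 < n.+1%:R^-1 / 2 :> R by rewrite divr_gt0 // invr_gt0 ltr0n.
have [p pa] := rational_near a e0; have [q qb] := rational_near b e0.
exists (p, q); apply: le_lt_trans (norm_complex_le _ _) _.
have -> : (n.+1%:R^-1 : C) = ((n.+1%:R^-1 : R)%:C)%C by rewrite fmorphV rmorph_nat.
by rewrite ltcR [ltRHS]splitr; exact: ltrD.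
Qed.

(** A base is given by the discs with Gaussian rational centres and radii
    [1/(n+1)]. *)
Lemma complex_second_countable : second_countable (T := C).
Proof.
pose D (t : rat * rat * nat) : set C :=
  ball (Complex (ratr t.1.1) (ratr t.1.2) : C) t.2.+1%:R^-1.
exists (range D); first exact: card_le_trans (card_image_le _ _) (countableP _).
split; first by move=> _ [t _ <-]; apply: ball_open; rewrite invr_gt0 ltr0n.
move=> x N /nbhs_ballP[e /= e0 eN].
have [n ne] : exists n, n.+1%:R^-1 < e / 2 by apply: ltr_natSinv; rewrite divr_gt0.
have [q xq] := rational_dense x n.
exists (D (q, n)).
  by split; [exists (q, n)|rewrite /D /= -ball_normE /= distrC].
move=> y; rewrite /D -ball_normE /= => yq; apply: eN; rewrite -ball_normE /=.
rewrite (splitr e) -(subrKA (Complex (ratr q.1) (ratr q.2))).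
apply: le_lt_trans (ler_normD _ _) _.
by apply: ltrD; [exact: lt_trans ne|exact: lt_trans ne].
Qed.

End ComplexNumbers.

(** * Conclusion *)

Section Conclusion.
Variable C : numClosedFieldType.

Lemma calDk_invertible k : invertible01 (@calDk C k).
Proof.
split; first exact: generated_subsheaf.
move=> p; have [i [x ->]] := P1_param p; exists (P1_dom i); split.
- exact: open_P1_dom.
- exact: param_dom.
- by exists (chart_generator k i); exact: chart_generator_basis.
Qed.

Lemma P12_N2_super_Riemann_surface : second_countable (T := C) ->
  N2_super_Riemann_surface (@calDk C false) (@calDk C true).
Proof.
move=> scC; split; [exact: P12_supermanifold|exact: calDk_invertible
  |exact: calDk_invertible|].
move=> p; have [i [x ->]] := P1_param p.
exists (P1_dom i), (chart_generator false i), (chart_generator true i); split.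
- by split; [exact: open_P1_dom|exact: param_dom].
- by split; exact: chart_generator_basis.
- by split; exact: chart_generator_integrable.
- exact: chart_generators_span.
Qed.

End Conclusion.

Theorem mainTheorem11 (R : realType) :
  (* the two displayed expressions agree and define global vector fields *)
  (forall a1 a2 : Cx R, D1 a1 a2 = D1_factored a1 a2 /\
     exists X : tfam (P12 (Cx R)), extends_to (D1 a1 a2) X) /\
  (forall b1 b2 : Cx R, D2 b1 b2 = D2_factored b1 b2 /\
     exists X : tfam (P12 (Cx R)), extends_to (D2 b1 b2) X) /\
  (* the subsheaves they generate *)
  invertible01 (@calD1 (Cx R)) /\ invertible01 (@calD2 (Cx R)) /\
  N2_super_Riemann_surface (@calD1 (Cx R)) (@calD2 (Cx R)).
Proof.
split=> [a b|].
  split; first exact: D1_factoredE.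
  by exists (global_section false a b); exact: (extends_global_section false).
split=> [a b|].
  split; first exact: D2_factoredE.
  by exists (global_section true a b); exact: (extends_global_section true).
split; first exact: (calDk_invertible _ false).
split; first exact: (calDk_invertible _ true).
exact: P12_N2_super_Riemann_surface (complex_second_countable R).
Qed.
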